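(* Let $n$ be a positive integer, let $X$ be a Hausdorff, second countable topological space equipped with an $n$-dimensional orbifold atlas, and equip $X$ with the diffeology determined by the atlas. For every diffeological differential form $\alpha$ on $X$, associating to every chart $(\tilde U,\Gamma,\phi)$ of the atlas the pullback $\phi^*\alpha$ defines an orbifold differential form on $X$. This gives a bijection between the diffeological differential forms on $X$ and the orbifold differential forms on $X$.
   Context: Orbifolds. An $n$-dimensional orbifold chart on $X$ is a triple $(\tilde U,\Gamma,\phi)$ where $\tilde U\subseteq\mathbb{R}^n$ is an open ball, $\Gamma$ is a finite group of diffeomorphisms of $\tilde U$, and $\phi\colon\tilde U\to X$ is a $\Gamma$-invariant map onto an open subset $U$ of $X$ that induces a homeomorphism $\tilde U/\Gamma\to U$. Two orbifold charts $(\tilde U,\Gamma,\phi)$ and $(\tilde V,\Gamma',\psi)$ are compatible if for every $u\in\tilde U$ and $v\in\tilde V$ with $\phi(u)=\psi(v)$ there exist a neighbourhood $O_u$ of $u$ in $\tilde U$, a neighbourhood $O_v$ of $v$ in $\tilde V$, and a diffeomorphism $g\colon O_u\to O_v$ with $g(u)=v$ and $\psi\circ g=\phi$. An orbifold atlas on $X$ is a set of pairwise compatible orbifold charts whose images cover $X$. Orbifold differential forms. An orbifold differential form on $X$ is given by a collection that assigns to each chart $(\tilde U,\Gamma,\phi)$ of the atlas a $\Gamma$-invariant differential form $\alpha_{\tilde U}$ on $\tilde U$, such that: for every two charts $(\tilde U,\Gamma,\phi)$, $(\tilde V,\Gamma',\psi)$ and points $u\in\tilde U$, $v\in\tilde V$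 with $\phi(u)=\psi(v)$, there exists a diffeomorphism $g\colon O_u\to O_v$ from a neighbourhood of $u$ to a neighbourhood of $v$ with $g(u)=v$, $\psi\circ g=\phi$, and $g^*(\alpha_{\tilde V}|_{O_v})=\alpha_{\tilde U}|_{O_u}$. Diffeology. A parametrisation on a set $X$ is a map $p\colon W\to X$ with $W$ open in some $\mathbb{R}^m$. A diffeology on $X$ is a set of parametrisations, called plots, containing all constant maps, closed under precomposition with smooth maps between open subsets of Euclidean spaces, and such that a parametrisation that is locally (near each point of its domain) a plot is a plot. A map between diffeological spaces is smooth if its composition with every plot of the source is a plot of the target. The diffeology on $X$ determined by the orbifold atlas is the one for which the homeomorphisms $\tilde U/\Gamma\to U$ are diffeomorphisms ($\tilde U/\Gamma$ having the quotient diffeology and $U$ the subset diffeology): its plots are the maps $p\colon W\to X$ such that each point of $W$ has an open neighbourhood $W'\subseteq W$, a chart $(\tilde U,\Gamma,\phi)$ and a smooth map $q\colon W'\to\tilde U$ with $p|_{W'}=\phi\circ q$. A diffeological differential $k$-form $\alpha$ on $X$ assigns to each plot $p\colon W\to X$ an ordinary form $\alpha(p)\in\Omega^k(W)$ such that $\alpha(p\circ F)=F^*(\alpha(p))$ for every smooth map $F\colon V\to W$ from an open subset $V$ of a Euclidean space. Since $\phi\colon\tilde U\to X$ is a plot, $\phi^*\alpha:=\alpha(\phi)$ is an ordinary differential form on $\tilde U$. *)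

(* Defs.v *)
From HB Require Import structures.
From mathcomp Require Import all_boot all_order all_algebra.
From mathcomp Require Import all_classical all_reals all_analysis.

Set Implicit Arguments.
Unset Strict Implicit.
Unset Printing Implicit Defensive.
Import Order.TTheory GRing.Theory Num.Theory.
Import numFieldNormedType.Exports.

Local Open Scope classical_set_scope.
Local Open Scope ring_scope.

(* A map whose mathematical domain is an open set [W] is a total function     *)
(* together with [W]; only its values on [W] are ever used.                   *)

Section Smooth.
Context {R : realType}.

Fixpoint Ck (r m : nat) (V : normedModType R) (W : set 'rV[R]_m)
    (f : 'rV[R]_m -> V) : Prop :=
  if r is r'.+1 then
    (forall x, W x -> differentiable f x) /\
    (forall v, Ck r' W (fun x => 'd f x v))
  else forall x, W x -> {for x, continuous f}.

Definition smooth (m : nat) (V : normedModType R) (W : set 'rV[R]_m)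
    (f : 'rV[R]_m -> V) : Prop :=
  forall r, Ck r W f.

Definition diffeo (m : nat) (U V : set 'rV[R]_m) (g : 'rV[R]_m -> 'rV[R]_m) :
    Prop :=
  [/\ open U, open V, smooth U g, g @` U `<=` V &
    exists h, [/\ smooth V h, h @` V `<=` U,
      {in U, cancel g h} & {in V, cancel h g}]].

Lemma near_eq_continuous (T T' : topologicalType) (f g : T -> T') (x : T) :
  (\forall y \near x, f y = g y) ->
  {for x, continuous f} -> {for x, continuous g}.
Proof.
move=> fg; rewrite /prop_for /continuous_at -(nbhs_singleton fg) => cf.
apply: cvg_trans cf; apply: near_eq_cvg.
by move: fg; apply: filterS => y.
Qed.

Lemma near_eq_diff (V V' : normedModType R) (f g : V -> V') (x : V) :
  (\forall y \near x, f y = g y) -> differentiable f x ->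
  differentiable g x /\ 'd g x = 'd f x :> (V -> V').
Proof.
move=> fg df.
have cf : continuous ('d f x) by exact: diff_continuous.
have /eqaddoP fo := diff_locally df.
have fgx : f x = g x by exact: nbhs_singleton fg.
have go : g \o shift x = cst (g x) + 'd f x +o_ (0 : V) id.
  apply/eqaddoP => e e0; have {}fo := fo e e0.
  have fg0 : \forall y \near (0 : V), f (y + x) = g (y + x).
    by move: fg; rewrite (near_shift 0 x) /= subr0.
  near=> y.
  have <- : (f \o shift x - (cst (f x) + 'd f x)) y
          = (g \o shift x - (cst (g x) + 'd f x)) y.
    rewrite !fctE /= fgx; congr (_ - _).
    by near: y.
  by near: y.
have gd : 'd g x = 'd f x :> (V -> V') by exact: diff_unique cf go.
by split=> //; apply/diff_locallyP; rewrite gd.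
Unshelve. all: by end_near. Qed.

Lemma Ck_ext r m (V : normedModType R) (W : set 'rV[R]_m)
    (f g : 'rV[R]_m -> V) :
  open W -> (forall x, W x -> f x = g x) -> Ck r W f -> Ck r W g.
Proof.
move=> oW; elim: r f g => [|r IH] f g fg.
  move=> cf x Wx; apply: near_eq_continuous (cf x Wx).
  by have := open_nbhs_nbhs (conj oW Wx); apply: filterS => y /fg.
move=> [df Cf].
have near_fg x : W x -> \forall y \near x, f y = g y.
  by move=> Wx; have := open_nbhs_nbhs (conj oW Wx); apply: filterS => y /fg.
split=> [x Wx|v].
  by have [] := near_eq_diff (near_fg x Wx) (df x Wx).
apply: IH (Cf v) => x Wx.
by have [_ ->] := near_eq_diff (near_fg x Wx) (df x Wx).
Qed.

Lemma CkS r m (V : normedModType R) (W : set 'rV[R]_m) (f : 'rV[R]_m -> V) :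
  Ck r.+1 W f -> Ck r W f.
Proof.
elim: r f => [|r IH] f [df Cf].
  by move=> x Wx; apply: differentiable_continuous; exact: df.
by split=> // v; apply: IH; exact: Cf.
Qed.

Lemma Ck_sub r m (V : normedModType R) (W W' : set 'rV[R]_m)
    (f : 'rV[R]_m -> V) :
  W' `<=` W -> Ck r W f -> Ck r W' f.
Proof.
move=> sW; elim: r f => [|r IH] f /=; first by move=> cf x /sW /cf.
by move=> [df Cf]; split=> [x /sW /df //|v]; exact: IH.
Qed.

Lemma Ck_cst r m (V : normedModType R) (W : set 'rV[R]_m) (a : V) :
  Ck r W (fun=> a).
Proof.
elim: r a => [|r IH] a /=; first by move=> x _; exact: cst_continuous.
split=> [x _|v]; first exact: differentiable_cst.
rewrite [X in Ck _ _ X](_ : _ = fun=> 0) //.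
by apply/funext => x; rewrite diff_cst.
Qed.

Lemma Ck_add r m (V : normedModType R) (W : set 'rV[R]_m)
    (f g : 'rV[R]_m -> V) :
  open W -> Ck r W f -> Ck r W g -> Ck r W (fun x => f x + g x).
Proof.
move=> oW; elim: r f g => [|r IH] f g /=.
  by move=> cf cg x Wx; apply: continuousD; [exact: cf|exact: cg].
move=> [df Cf] [dg Cg]; split=> [x Wx|v].
  by apply: differentiableD; [exact: df|exact: dg].
apply: Ck_ext (IH _ _ (Cf v) (Cg v)) => // x Wx.
by rewrite -[fun y => f y + g y]/(f + g) (diffD (df x Wx) (dg x Wx)).
Qed.

Lemma Ck_sum r m (V : normedModType R) (W : set 'rV[R]_m) (n : nat)
    (f : 'I_n -> 'rV[R]_m -> V) :
  open W -> (forall i, Ck r W (f i)) -> Ck r W (fun x => \sum_i f i x).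
Proof.
move=> oW Cf; elim: (index_enum _) => [|i s IH].
  by under eq_fun do rewrite big_nil; exact: Ck_cst.
under eq_fun do rewrite big_cons.
exact: Ck_add.
Qed.

Lemma is_diff_scale (U V : normedModType R) (c : U -> R) (f : U -> V) (x : U) :
  differentiable c x -> differentiable f x ->
  differentiable (fun y => c y *: f y) x /\
  forall v, 'd (fun y => c y *: f y) x v = c x *: 'd f x v + 'd c x v *: f x.
Proof.
move=> dc df.
have sbil : bilinear_for (GRing.Scale.Law.clone _ _ *:%R _)
    (GRing.Scale.Law.clone _ _ *:%R _) (fun (a : R) (u : V) => a *: u).
  split=> [u|a] k y z /=; first by rewrite scalerDl scalerA.
  by rewrite scalerDr !scalerA mulrC.
pose sM := bilinear_isBilinear.Build R R V V _ _ _ sbil.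
pose sB : {bilinear R -> V -> V} := HB.pack (fun (a : R) (u : V) => a *: u) sM.
have cB : continuous (fun p : R * V => sB p.1 p.2) by exact: scale_continuous.
have dp : differentiable (fun y => (c y, f y)) x by exact: differentiable_pair.
have dB := differentiable_bilin (c x, f x) cB.
rewrite -[fun y => c y *: f y]/((fun p : R * V => sB p.1 p.2) \o
  (fun y => (c y, f y))); split=> [|v]; first exact: differentiable_comp.
by rewrite (diff_comp dp dB) /= (diff_bilin _ cB) /= (diff_pair dc df).
Qed.

Lemma Ck_scale r m (V : normedModType R) (W : set 'rV[R]_m)
    (c : 'rV[R]_m -> R) (f : 'rV[R]_m -> V) :
  open W -> Ck r W c -> Ck r W f -> Ck r W (fun x => c x *: f x).
Proof.
move=> oW; elim: r c f => [|r IH] c f.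
  by move=> cc cf x Wx; apply: continuousZ; [exact: cc|exact: cf].
move=> C1c C1f; have [dc Cc] := C1c; have [df Cf] := C1f.
split=> [x Wx|v]; first by have [] := is_diff_scale (dc x Wx) (df x Wx).
have := Ck_add oW (IH _ _ (CkS C1c) (Cf v)) (IH _ _ (Cc v) (CkS C1f)).
apply: Ck_ext => // x Wx.
by have [_ ->] := is_diff_scale (dc x Wx) (df x Wx).
Qed.

Lemma Ck_linear_comp r m (V V' : normedModType R) (W : set 'rV[R]_m)
    (L : {linear V -> V'}) (f : 'rV[R]_m -> V) :
  open W -> continuous L -> Ck r W f -> Ck r W (fun x => L (f x)).
Proof.
move=> oW cL; elim: r f => [|r IH] f /=.
  by move=> cf x Wx; apply: continuous_comp; [exact: cf|exact: cL].
move=> [df Cf]; have dL y : differentiable L y by exact: linear_differentiable.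
split=> [x Wx|v].
  by apply: (@differentiable_comp _ _ _ _ f L); [exact: df|exact: dL].
apply: Ck_ext (IH _ (Cf v)) => // x Wx.
rewrite -[fun y => L (f y)]/(L \o f) (diff_comp (df x Wx) (dL (f x))) /=.
by rewrite diff_lin.
Qed.

Lemma Ck_coord r m n (W : set 'rV[R]_m) (f : 'rV[R]_m -> 'rV[R]_n) i :
  open W -> Ck r W f -> Ck r W (fun x => f x 0 i).
Proof.
move=> oW Cf.
have lin : linear (fun u : 'rV[R]_n => u 0 i) by move=> a u v; rewrite !mxE.
pose LM := GRing.isLinear.Build R 'rV[R]_n R _ _ lin.
pose L : {linear 'rV[R]_n -> R} := HB.pack (fun u : 'rV[R]_n => u 0 i) LM.
by apply: (@Ck_linear_comp r m _ _ W L f) => //; exact: coord_continuous.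
Qed.

Lemma Ck_comp r l m (V : normedModType R) (W : set 'rV[R]_l)
    (W' : set 'rV[R]_m) (f : 'rV[R]_l -> 'rV[R]_m) (g : 'rV[R]_m -> V) :
  open W -> f @` W `<=` W' -> Ck r W f -> Ck r W' g -> Ck r W (g \o f).
Proof.
move=> oW fW; have {}fW x : W x -> W' (f x) by move=> Wx; apply: fW; exists x.
elim: r g => [|r IH] g.
  by move=> cf cg x Wx; apply: continuous_comp; [exact: cf|exact/cg/fW].
move=> C1f [dg Cg]; have [df Cf] := C1f.
have dgf x : W x -> differentiable (g \o f) x.
  by move=> Wx; apply: differentiable_comp; [exact: df|exact/dg/fW].
split=> // v.
have C i : Ck r W (fun x => 'd f x v 0 i *: 'd g (f x) (delta_mx 0 i)).
  apply: Ck_scale => //; first exact: (Ck_coord _ oW (Cf v)).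
  by apply: (IH (fun y => 'd g y (delta_mx 0 i))); [exact: CkS|exact: Cg].
apply: Ck_ext (Ck_sum oW C) => // x Wx.
rewrite (diff_comp (df x Wx) (dg _ (fW x Wx))) /=.
rewrite [in RHS](row_sum_delta ('d f x v)) linear_sum.
by apply: eq_bigr => i _; rewrite linearZ.
Qed.

Lemma smooth_comp l m (V : normedModType R) (W : set 'rV[R]_l)
    (W' : set 'rV[R]_m) (f : 'rV[R]_l -> 'rV[R]_m) (g : 'rV[R]_m -> V) :
  open W -> f @` W `<=` W' -> smooth W f -> smooth W' g -> smooth W (g \o f).
Proof. by move=> oW fW Sf Sg r; exact: (Ck_comp oW fW (Sf r) (Sg r)). Qed.

Lemma smooth_sub m (V : normedModType R) (W W' : set 'rV[R]_m)
    (f : 'rV[R]_m -> V) :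
  W' `<=` W -> smooth W f -> smooth W' f.
Proof. by move=> sW Sf r; exact: Ck_sub sW (Sf r). Qed.

Lemma smooth_cst m (V : normedModType R) (W : set 'rV[R]_m) (a : V) :
  smooth W (fun=> a).
Proof. by move=> r; exact: Ck_cst. Qed.

Lemma smooth_id m (W : set 'rV[R]_m) : smooth W id.
Proof.
move=> [|r]; first by move=> x _; exact: cvg_id.
split=> [x _|v]; first exact: ex_diff.
rewrite [X in Ck _ _ X](_ : _ = fun=> v); first exact: Ck_cst.
by apply/funext => x; rewrite diff_val.
Qed.

End Smooth.

Section Forms.
Context {R : realType}.

Definition multilinear (k m : nat) (w : ('I_k -> 'rV[R]_m) -> R) : Prop :=
  forall (v : 'I_k -> 'rV[R]_m) (i : 'I_k) (a : R) (x y : 'rV[R]_m),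
    w [eta v with i |-> a *: x + y] =
    a * w [eta v with i |-> x] + w [eta v with i |-> y].

Definition alternating (k m : nat) (w : ('I_k -> 'rV[R]_m) -> R) : Prop :=
  forall (v : 'I_k -> 'rV[R]_m) (i j : 'I_k), i != j -> v i = v j -> w v = 0.

(* Forms are extended by zero outside [W], so that Leibniz equality of        *)
(* [form k W] is equality of differential [k]-forms on [W].                   *)
Record form (k m : nat) (W : set 'rV[R]_m) : Type := Form {
  form_val :> 'rV[R]_m -> ('I_k -> 'rV[R]_m) -> R ;
  form_multilinear : forall x, W x -> multilinear (form_val x) ;
  form_alternating : forall x, W x -> alternating (form_val x) ;
  form_smooth : forall v, smooth W (fun x => form_val x v) ;
  form_out : forall x v, ~ W x -> form_val x v = 0 }.

Definition pullback (k l m : nat) (F : 'rV[R]_l -> 'rV[R]_m)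
    (w : 'rV[R]_m -> ('I_k -> 'rV[R]_m) -> R) :
    'rV[R]_l -> ('I_k -> 'rV[R]_l) -> R :=
  fun x v => w (F x) (fun i => 'd F x (v i)).

Definition eq_form_on (k m : nat) (W : set 'rV[R]_m)
    (w w' : 'rV[R]_m -> ('I_k -> 'rV[R]_m) -> R) : Prop :=
  forall x, W x -> w x = w' x.

End Forms.

Section Diffeology.
Context {R : realType}.

Record diffeology (X : Type) : Type := Diffeology {
  plot : forall m : nat, set 'rV[R]_m -> ('rV[R]_m -> X) -> Prop ;
  plot_open : forall m (W : set 'rV[R]_m) p, plot W p -> open W ;
  (* being a plot depends only on the values on the domain *)
  plot_ext : forall m (W : set 'rV[R]_m) (p q : 'rV[R]_m -> X),
    {in W, p =1 q} -> plot W p -> plot W q ;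
  plot_cst : forall m (W : set 'rV[R]_m) (x : X), open W -> plot W (fun=> x) ;
  plot_comp : forall l m (V : set 'rV[R]_l) (W : set 'rV[R]_m)
      (F : 'rV[R]_l -> 'rV[R]_m) (p : 'rV[R]_m -> X),
    open V -> smooth V F -> F @` V `<=` W -> plot W p -> plot V (p \o F) ;
  plot_local : forall m (W : set 'rV[R]_m) (p : 'rV[R]_m -> X), open W ->
    (forall x, W x -> exists W' : set 'rV[R]_m,
      [/\ W' x, W' `<=` W & plot W' p]) ->
    plot W p }.

(* The condition alpha(p \o F) = F^* alpha(p) is stated for every plot [q]    *)
(* agreeing with [p \o F] on [V]: with [F = id], it makes [dform_val] depend  *)
(* only on the restriction of a plot to its domain.                           *)
Record diffeological_form (X : Type) (D : diffeology X) (k : nat) : Type :=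
    DiffeologicalForm {
  dform_val :> forall (m : nat) (W : set 'rV[R]_m) (p : 'rV[R]_m -> X),
    plot D W p -> form k W ;
  dform_pullback : forall l m (V : set 'rV[R]_l) (W : set 'rV[R]_m)
      (F : 'rV[R]_l -> 'rV[R]_m) (p : 'rV[R]_m -> X) (q : 'rV[R]_l -> X)
      (Wp : plot D W p) (Vq : plot D V q),
    smooth V F -> F @` V `<=` W -> {in V, q =1 p \o F} ->
    eq_form_on V (dform_val Vq) (pullback F (dform_val Wp)) }.

End Diffeology.

Section Orbifold.
Context {R : realType} {n : nat} {X : topologicalType}.

(* The norm of ['rV[R]_n] is the sup norm, so [ball] would be a cube. *)
Definition euclidean_ball (c : 'rV[R]_n) (r : R) : set 'rV[R]_n :=
  [set x | \sum_i (x 0 i - c 0 i) ^+ 2 < r ^+ 2].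

(* A diffeomorphism of [U] is extended by the identity outside [U], so that   *)
(* the elements of [G] correspond one-to-one to diffeomorphisms of [U].       *)
Definition finite_diffeo_group (U : set 'rV[R]_n)
    (G : set ('rV[R]_n -> 'rV[R]_n)) : Prop :=
  [/\ finite_set G,
      forall g, G g -> diffeo U U g /\ (forall x, ~ U x -> g x = x),
      G id,
      forall g h, G g -> G h -> G (g \o h) &
      forall g, G g -> exists2 h, G h & cancel g h /\ cancel h g].

Definition orbit (G : set ('rV[R]_n -> 'rV[R]_n)) (x : 'rV[R]_n) :
    set 'rV[R]_n :=
  [set g x | g in G].

Definition orbit_space (U : set 'rV[R]_n) (G : set ('rV[R]_n -> 'rV[R]_n)) :
    set (set 'rV[R]_n) :=
  [set orbit G x | x in U].

Definition quotient_open (U : set 'rV[R]_n) (G : set ('rV[R]_n -> 'rV[R]_n))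
    (Q : set (set 'rV[R]_n)) : Prop :=
  Q `<=` orbit_space U G /\ open (U `&` orbit G @^-1` Q).

(* As [V] is open in [X], the open sets of the subspace [V] are the open sets *)
(* of [X] contained in [V].                                                   *)
Definition quotient_homeo (U : set 'rV[R]_n) (G : set ('rV[R]_n -> 'rV[R]_n))
    (V : set X) (f : set 'rV[R]_n -> X) : Prop :=
  set_bij (orbit_space U G) V f /\
  forall Q, Q `<=` orbit_space U G -> (quotient_open U G Q <-> open (f @` Q)).

Record chart : Type := Chart {
  chart_dom : set 'rV[R]_n ;
  chart_group : set ('rV[R]_n -> 'rV[R]_n) ;
  chart_map : 'rV[R]_n -> X ;
  chart_dom_ball : exists c r, 0 < r /\ chart_dom = euclidean_ball c r ;
  chart_groupP : finite_diffeo_group chart_dom chart_group ;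
  chart_invariant : forall g x, chart_group g -> chart_dom x ->
    chart_map (g x) = chart_map x ;
  chart_img_open : open (chart_map @` chart_dom) ;
  chart_homeo : exists f : set 'rV[R]_n -> X,
    (forall x, chart_dom x -> f (orbit chart_group x) = chart_map x) /\
    quotient_homeo chart_dom chart_group (chart_map @` chart_dom) f }.

(* [g : O -> O'] is a diffeomorphism from a neighbourhood of [u] to a         *)
(* neighbourhood of [v] commuting with the charts.                            *)
Definition transition (c d : chart) (u v : 'rV[R]_n) (O O' : set 'rV[R]_n)
    (g : 'rV[R]_n -> 'rV[R]_n) : Prop :=
  [/\ O u /\ O `<=` chart_dom c, O' v /\ O' `<=` chart_dom d, diffeo O O' g,
      g u = v & {in O, chart_map d \o g =1 chart_map c}].

Definition compatible (c d : chart) : Prop :=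
  forall u v, chart_dom c u -> chart_dom d v -> chart_map c u = chart_map d v ->
    exists O O' g, transition c d u v O O' g.

Record orbifold_atlas : Type := OrbifoldAtlas {
  charts : set chart ;
  charts_compatible : forall c d, charts c -> charts d -> compatible c d ;
  charts_cover : \bigcup_(c in charts) (chart_map c @` chart_dom c) = setT }.

Record orbifold_form (A : orbifold_atlas) (k : nat) : Type := OrbifoldForm {
  oform_val :> forall c, charts A c -> form k (chart_dom c) ;
  oform_invariant : forall c (Ac : charts A c) g, chart_group c g ->
    eq_form_on (chart_dom c) (pullback g (oform_val Ac)) (oform_val Ac) ;
  oform_transition : forall c d (Ac : charts A c) (Ad : charts A d) u v,
    chart_dom c u -> chart_dom d v -> chart_map c u = chart_map d v ->
    exists O O' g, transition c d u v O O' g /\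
      eq_form_on O (pullback g (oform_val Ad)) (oform_val Ac) }.

Variable A : orbifold_atlas.

Definition orbifold_plot (m : nat) (W : set 'rV[R]_m) (p : 'rV[R]_m -> X) :
    Prop :=
  open W /\ forall x, W x -> exists W' : set 'rV[R]_m,
    [/\ open W', W' x, W' `<=` W & exists c (q : 'rV[R]_m -> 'rV[R]_n),
      [/\ charts A c, smooth W' q, q @` W' `<=` chart_dom c &
        {in W', p =1 chart_map c \o q}]].

Lemma orbifold_plot_ext m (W : set 'rV[R]_m) (p q : 'rV[R]_m -> X) :
  {in W, p =1 q} -> orbifold_plot W p -> orbifold_plot W q.
Proof.
move=> pq [oW Wp]; split=> // x /Wp[W' [oW' W'x sW [c [f [Ac Sf fc pf]]]]].
exists W'; split=> //; exists c, f; split=> // y W'y.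
by rewrite -pf // pq //; move: W'y; rewrite !inE => /sW.
Qed.

Lemma orbifold_plot_cst m (W : set 'rV[R]_m) (x : X) :
  open W -> orbifold_plot W (fun=> x).
Proof.
move=> oW; split=> // y Wy; exists W; split=> //.
have : [set: X] x by [].
rewrite -(charts_cover A) => -[c Ac [u cu ux]].
exists c, (fun=> u); split=> //; first exact: smooth_cst.
by move=> _ [z _ <-].
Qed.

Lemma orbifold_plot_comp l m (V : set 'rV[R]_l) (W : set 'rV[R]_m)
    (F : 'rV[R]_l -> 'rV[R]_m) (p : 'rV[R]_m -> X) :
  open V -> smooth V F -> F @` V `<=` W -> orbifold_plot W p ->
  orbifold_plot V (p \o F).
Proof.
move=> oV SF FV [oW Wp]; split=> // x Vx.
have [|W' [oW' W'Fx sW [c [q [Ac Sq qc pq]]]]] := Wp (F x).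
  by apply: FV; exists x.
have [V' [oV' V'x sV FV']] : exists V' : set 'rV[R]_l,
    [/\ open V', V' x, V' `<=` V & F @` V' `<=` W'].
  have cF : {for x, continuous F} by exact: (SF 0%N).
  have : nbhs x (V `&` F @^-1` W').
    by apply: filterI; [exact: open_nbhs_nbhs|exact/cF/open_nbhs_nbhs].
  rewrite nbhsE => -[V' [oV' V'x] sV']; exists V'; split=> //.
    by move=> y /sV' [].
  by move=> _ [y /sV' [_ ?] <-].
exists V'; split=> //; exists c, (q \o F); split=> //.
- by apply: smooth_comp FV' _ Sq => //; exact: smooth_sub sV SF.
- by move=> _ [y V'y <-]; apply: qc; exists (F y) => //; apply: FV'; exists y.
- by move=> y; rewrite inE => V'y /=; rewrite pq // inE; apply: FV'; exists y.
Qed.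

Lemma orbifold_plot_local m (W : set 'rV[R]_m) (p : 'rV[R]_m -> X) :
  open W ->
  (forall x, W x -> exists W' : set 'rV[R]_m,
    [/\ W' x, W' `<=` W & orbifold_plot W' p]) ->
  orbifold_plot W p.
Proof.
move=> oW Wp; split=> // x /Wp[W' [W'x sW [_ /(_ x W'x)]]].
move=> [W'' [oW'' W''x sW' H]]; exists W''; split=> //.
exact: subset_trans sW' sW.
Qed.

Definition orbifold_diffeology : diffeology X :=
  Diffeology (fun m (W : set 'rV[R]_m) p (Wp : orbifold_plot W p) => proj1 Wp)
    orbifold_plot_ext orbifold_plot_cst orbifold_plot_comp orbifold_plot_local.

Lemma euclidean_ball_open c r : open (euclidean_ball c r).
Proof.
pose N (x : 'rV[R]_n) := \sum_i (x 0 i - c 0 i) ^+ 2.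
have cN : continuous N.
  suff : Ck 0 setT N by move=> H x; exact: H.
  apply: (@Ck_sum _ 0 n R setT n (fun i x => (x 0 i - c 0 i) ^+ 2)).
    exact: openT.
  move=> i.
  have C : Ck 0 setT (fun x : 'rV[R]_n => x 0 i - c 0 i).
    apply: Ck_add; first exact: openT.
      by apply: (@Ck_coord _ 0 n n setT id); [exact: openT|exact: smooth_id].
    exact: Ck_cst.
  exact: (Ck_scale openT C C).
have -> : euclidean_ball c r = N @^-1` [set y | y < r ^+ 2] by [].
by apply: open_comp => [x _|]; [exact: cN|exact: open_lt].
Qed.

Lemma chart_plot c :
  charts A c -> plot orbifold_diffeology (chart_dom c) (chart_map c).
Proof.
move=> Ac; have oc : open (chart_dom c).
  by have [b [r [_ ->]]] := chart_dom_ball c; exact: euclidean_ball_open.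
split=> // x cx; exists (chart_dom c); split=> //.
exists c, id; split=> //; first exact: smooth_id.
by move=> _ [y cy <-].
Qed.

End Orbifold.

Arguments chart R n X : clear implicits.
Arguments orbifold_atlas R n X : clear implicits.

(* Main.v *)
From HB Require Import structures.
From mathcomp Require Import all_boot all_order all_algebra.
From mathcomp Require Import all_classical all_reals all_analysis.
Require Import Defs.

(** Every plot of an orbifold lifts locally to the charts: near each point of
    its domain it is [chart_map c \o q] for a chart [c] and a smooth [q].
    A diffeological form [a] must therefore take on it the value [q^* (a c)],
    where [a c] is its value on the plot [chart_map c]; so [a] is determined by
    its values on the charts. These values are invariant under the chart groups
    and matched by every transition map, since both are instances of the
    compatibility of [a] with smooth reparametrisation.

    Conversely, given an orbifold form [w], one wants to define its value on a
    plot by [q^* (w c)] for any local lift [q]. The whole difficulty is that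
    this must not depend on the lift ([orbifold_pullback_lift_unique]). Near a
    point, a transition map that matches the forms moves one of the two lifts
    into the chart of the other, so both may be assumed to be lifts [q], [q']
    to a single chart ([pullback_lift_unique]). Pointwise [q y = g (q' y)] for
    some [g] in the finite chart group, but [g] depends on [y], and it may be
    impossible to choose it continuously. However, any nonempty open set
    contains a nonempty open subset on which one [g] works
    ([finite_coincidence]), and there invariance of the form gives
    [q^* w = q'^* g^* w = q'^* w]. The two pullbacks thus agree on a dense set,
    hence everywhere, being continuous. *)

Set Implicit Arguments.
Unset Strict Implicit.
Unset Printing Implicit Defensive.
Import Order.TTheory GRing.Theory Num.Theory.
Import numFieldNormedType.Exports.

Local Open Scope classical_set_scope.
Local Open Scope ring_scope.

(** * Smooth maps *)

Section SmoothMaps.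
Context {R : realType}.

Lemma smooth_differentiable (m : nat) (V : normedModType R)
    (W : set 'rV[R]_m) (f : 'rV[R]_m -> V) x :
  smooth W f -> W x -> differentiable f x.
Proof. by move=> /(_ 1%N) [df _]; exact: df. Qed.

Lemma smooth_continuous (m : nat) (V : normedModType R)
    (W : set 'rV[R]_m) (f : 'rV[R]_m -> V) x :
  smooth W f -> W x -> {for x, continuous f}.
Proof. by move=> Sf; exact: (Sf 0%N). Qed.

Lemma smooth_ext (m : nat) (V : normedModType R) (W : set 'rV[R]_m)
    (f g : 'rV[R]_m -> V) :
  open W -> (forall x, W x -> f x = g x) -> smooth W f -> smooth W g.
Proof. by move=> oW fg Sf r; exact: Ck_ext oW fg (Sf r). Qed.

Lemma smooth_mul (m : nat) (W : set 'rV[R]_m) (f g : 'rV[R]_m -> R) :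
  open W -> smooth W f -> smooth W g -> smooth W (fun x => f x * g x).
Proof. by move=> oW Sf Sg r; exact: (Ck_scale oW (Sf r) (Sg r)). Qed.

Lemma smooth_coord (m p : nat) (W : set 'rV[R]_m) (f : 'rV[R]_m -> 'rV[R]_p) i :
  open W -> smooth W f -> smooth W (fun x => f x 0 i).
Proof. by move=> oW Sf r; exact: (Ck_coord i oW (Sf r)). Qed.

Lemma smooth_sum (m p : nat) (V : normedModType R) (W : set 'rV[R]_m)
    (f : 'I_p -> 'rV[R]_m -> V) :
  open W -> (forall i, smooth W (f i)) -> smooth W (fun x => \sum_i f i x).
Proof. by move=> oW Sf r; apply: Ck_sum => // i; exact: Sf. Qed.

Lemma smoothB (m : nat) (W : set 'rV[R]_m) (f g : 'rV[R]_m -> R) :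
  open W -> smooth W f -> smooth W g -> smooth W (fun x => f x - g x).
Proof.
move=> oW Sf Sg.
have SNg : smooth W (fun x => - 1 * g x).
  by apply: smooth_mul => //; exact: smooth_cst.
have SfNg : smooth W (fun x => f x + - 1 * g x).
  by move=> r; exact: (Ck_add oW (Sf r) (SNg r)).
by apply: smooth_ext SfNg => // x _; rewrite mulN1r.
Qed.

Lemma smooth_local (m : nat) (V : normedModType R) (W : set 'rV[R]_m)
    (f : 'rV[R]_m -> V) :
  (forall x, W x -> exists2 N : set 'rV[R]_m, N x & smooth N f) -> smooth W f.
Proof.
move=> loc r; have {loc} : forall x, W x ->
    exists2 N : set 'rV[R]_m, N x & Ck r N f.
  by move=> x /loc[N Nx Sf]; exists N => //; exact: Sf.
elim: r f => [|r IH] f loc /=.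
  by move=> x /loc[N Nx cf]; apply: cf.
split=> [x /loc[N Nx [df _]]|v]; first exact: df.
by apply: IH => x /loc[N Nx [_ Cf]]; exists N => //; exact: Cf.
Qed.

Lemma open_preimage_smooth (l : nat) (V : normedModType R) (N : set 'rV[R]_l)
    (q : 'rV[R]_l -> V) (O : set V) :
  open N -> smooth N q -> open O -> open (N `&` q @^-1` O).
Proof.
move=> oN Sq oO; rewrite openE => x [Nx Ox]; apply: filterI.
  exact: open_nbhs_nbhs.
by apply: (smooth_continuous Sq Nx); exact: open_nbhs_nbhs.
Qed.

Lemma smooth_comp_preimage (l m : nat) (V : normedModType R)
    (N : set 'rV[R]_l) (O : set 'rV[R]_m) (q : 'rV[R]_l -> 'rV[R]_m)
    (g : 'rV[R]_m -> V) :
  open N -> smooth N q -> open O -> smooth O g ->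
  smooth (N `&` q @^-1` O) (g \o q).
Proof.
move=> oN Sq oO Sg; have oM := open_preimage_smooth oN Sq oO.
have qO : q @` (N `&` q @^-1` O) `<=` O by move=> _ [x [_ Ox] <-].
exact: (smooth_comp oM qO (smooth_sub (@subIsetl _ _ _) Sq) Sg).
Qed.

End SmoothMaps.

(** * Pullback of differential forms *)

Section Pullback.
Context {R : realType}.

(** Forms vanish outside [W], so their values on [W] determine them. *)
Lemma form_eq (k m : nat) (W : set 'rV[R]_m) (w w' : form k W) :
  eq_form_on W w w' -> w = w'.
Proof.
case: w => f fm fa fs fo; case: w' => g gm ga gs go /= fg.
have E : f = g.
  apply/funext => x; have [Wx|nWx] := pselect (W x); first exact: fg.
  by apply/funext => v; rewrite fo // go.
by subst g; congr Form; exact: Prop_irrelevance.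
Qed.

Lemma pullback_id (k m : nat) (w : 'rV[R]_m -> ('I_k -> 'rV[R]_m) -> R) :
  pullback id w = w.
Proof.
apply/funext => x; apply/funext => v; rewrite /pullback.
by congr (w x _); apply/funext => i; rewrite diff_val.
Qed.

Lemma pullback_comp (k l m n : nat) (F : 'rV[R]_l -> 'rV[R]_m)
    (G : 'rV[R]_m -> 'rV[R]_n) (w : 'rV[R]_n -> ('I_k -> 'rV[R]_n) -> R) x :
  differentiable F x -> differentiable G (F x) ->
  pullback (G \o F) w x = pullback F (pullback G w) x.
Proof.
move=> dF dG; apply/funext => v; rewrite /pullback.
by congr (w _ _); apply/funext => i; rewrite diff_comp.
Qed.

(** The differential depends only on the germ. *)
Lemma near_eq_pullback (k l m : nat) (F G : 'rV[R]_l -> 'rV[R]_m)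
    (w : 'rV[R]_m -> ('I_k -> 'rV[R]_m) -> R) x :
  (\forall y \near x, F y = G y) -> differentiable F x ->
  pullback F w x = pullback G w x.
Proof.
move=> FG dF; apply/funext => v; rewrite /pullback.
have Fx : F x = G x by exact: nbhs_singleton FG.
have dFG : 'd G x = 'd F x :> ('rV_l -> 'rV_m).
  by have [_ E] := near_eq_diff FG dF; exact: E.
rewrite Fx.
exact: (congr1 (fun h : 'rV_l -> 'rV_m => w (G x) (h \o v)) (esym dFG)).
Qed.

Lemma multilinear_sum (k m p : nat) (w : ('I_k -> 'rV[R]_m) -> R) v i
    (c : 'I_p -> R) (y : 'I_p -> 'rV[R]_m) :
  multilinear w ->
  w [eta v with i |-> \sum_l c l *: y l] =
  \sum_l c l * w [eta v with i |-> y l].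
Proof.
move=> mw.
have lin : linear (fun z => w [eta v with i |-> z]) by move=> a u z; exact: mw.
pose LM := GRing.isLinear.Build R 'rV[R]_m R _ _ lin.
pose L : {linear 'rV[R]_m -> R} := HB.pack (fun z => w [eta v with i |-> z]) LM.
rewrite -[LHS]/(L _) linear_sum; apply: eq_bigr => j _.
by rewrite linearZ.
Qed.

(** Forms are only known to be smooth in the point for fixed vectors. When the
    vectors [u i] move as well, multilinearity reduces to that case: expanding
    each [u i] in the standard basis leaves smooth coefficients in front of the
    values of [w] on constant vectors. *)
Lemma smooth_form_apply (k l m : nat) (V : set 'rV[R]_l) (W : set 'rV[R]_m)
    (F : 'rV[R]_l -> 'rV[R]_m) (w : form k W)
    (u : 'I_k -> 'rV[R]_l -> 'rV[R]_m) :
  open V -> F @` V `<=` W -> smooth V F -> (forall i, smooth V (u i)) ->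
  smooth V (fun x => w (F x) (u^~ x)).
Proof.
move=> oV FV SF Su.
(* The vectors are made constant one at a time; [j] bounds the moving ones. *)
suff H j : (forall i : 'I_k, (j <= i)%N -> exists a, u i = fun=> a) ->
    smooth V (fun x => w (F x) (u^~ x)).
  by apply: (H k) => i; rewrite leqNgt ltn_ord.
elim: j u Su => [|j IH] u Su cu.
  have /choice[a ua] : forall i, exists a, u i = fun=> a by move=> i; exact: cu.
  have -> : (fun x => w (F x) (u^~ x)) = (w^~ a) \o F.
    by apply/funext => x /=; congr (w _ _); apply/funext => i; rewrite ua.
  exact: smooth_comp oV FV SF (form_smooth _ _).
have [jk|kj] := ltnP j k; last first.
  by apply: IH => // i; rewrite leqNgt (leq_trans (ltn_ord i)).
pose i0 := Ordinal jk.
pose u' (h : 'I_m) := [eta u with i0 |-> (fun=> delta_mx 0 h : 'rV[R]_m)].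
have S h : smooth V (fun x => u i0 x 0 h * w (F x) (u' h ^~ x)).
  have Sw : smooth V (fun x => w (F x) (u' h ^~ x)).
    apply: IH => [i|i ji] /=.
      by case: eqP => _; [exact: smooth_cst|exact: Su].
    case: eqP => [_|/eqP ne]; first by eexists.
    by apply: cu; rewrite ltn_neqAle ji andbT eq_sym.
  by apply: smooth_mul => //; exact: smooth_coord.
have Ssum : smooth V (fun x => \sum_h u i0 x 0 h * w (F x) (u' h ^~ x)).
  exact: smooth_sum.
apply: smooth_ext Ssum => // x Vx.
have WFx : W (F x) by apply: FV; exists x.
have -> : u^~ x = [eta u^~ x with i0 |-> \sum_h u i0 x 0 h *: delta_mx 0 h].
  by apply/funext => i /=; case: eqP => [->|//]; exact: row_sum_delta.
rewrite multilinear_sum; last exact: form_multilinear.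
apply: eq_bigr => h _; congr (_ * w _ _).
by apply/funext => i /=; case: eqP.
Qed.

Lemma pullback_smooth (k l m : nat) (V : set 'rV[R]_l) (W : set 'rV[R]_m)
    (F : 'rV[R]_l -> 'rV[R]_m) (w : form k W) v :
  open V -> F @` V `<=` W -> smooth V F ->
  smooth V (fun x => pullback F w x v).
Proof.
move=> oV FV SF.
apply: (smooth_form_apply w (u := fun i x => 'd F x (v i))) => // i r.
by have [_] := SF r.+1; exact.
Qed.

Lemma pullback_multilinear (k l m : nat) (F : 'rV[R]_l -> 'rV[R]_m)
    (w : 'rV[R]_m -> ('I_k -> 'rV[R]_m) -> R) x :
  multilinear (w (F x)) -> multilinear (pullback F w x).
Proof.
move=> mw v i a y z; rewrite /pullback.
have E t : (fun j => 'd F x ([eta v with i |-> t] j)) =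
    [eta (fun j => 'd F x (v j)) with i |-> 'd F x t].
  by apply/funext => j /=; case: eqP.
by rewrite !E linearP mw.
Qed.

Lemma pullback_alternating (k l m : nat) (F : 'rV[R]_l -> 'rV[R]_m)
    (w : 'rV[R]_m -> ('I_k -> 'rV[R]_m) -> R) x :
  alternating (w (F x)) -> alternating (pullback F w x).
Proof. by move=> aw v i j ij vij; apply: (aw _ i j ij); rewrite vij. Qed.

End Pullback.

(** * Independence of the lift of a plot *)

(** If [f] and the first candidate [g i] do not agree on all of [B], then they
    differ on a nonempty open subset of [B], the target being Hausdorff, and
    there one candidate fewer remains. *)
Lemma finite_coincidence (T V : topologicalType) (I : eqType) (s : seq I)
    (f : T -> V) (g : I -> T -> V) (B : set T) :
  hausdorff_space V -> open B -> B !=set0 ->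
  (forall y, B y -> {for y, continuous f}) ->
  (forall i y, i \in s -> B y -> {for y, continuous (g i)}) ->
  (forall y, B y -> exists2 i, i \in s & f y = g i y) ->
  exists2 i, i \in s & exists B',
    [/\ open B', B' !=set0, B' `<=` B & forall y, B' y -> f y = g i y].
Proof.
rewrite open_hausdorff => hV.
elim: s B => [|i s IH] B oB [x Bx] cf cg cov; first by have [] := cov x Bx.
have [all_eq|/existsNP[y /not_implyP[By ne]]] :=
  pselect (forall y, B y -> f y = g i y).
  by exists i; [exact: mem_head|exists B; split=> //; exists x].
pose B1 := B `&` [set y | f y <> g i y].
have B1B : B1 `<=` B by move=> z [].
have oB1 : open B1.
  rewrite openE => z [Bz /eqP/hV[[U U'] /=]]; rewrite !inE.
  move=> [Ufz U'gz] [oU oU' UU']; apply: filterI.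
    exact: open_nbhs_nbhs.
  have nU : \forall t \near z, U (f t).
    by apply: (cf z Bz); exact: open_nbhs_nbhs.
  have nU' : \forall t \near z, U' (g i t).
    by apply: (cg i z (mem_head _ _) Bz); exact: open_nbhs_nbhs.
  apply: filterS2 nU nU' => t Uft U'gt /= E.
  have : (U `&` U') (f t) by split=> //; rewrite /= E.
  by rewrite UU'.
have [|||||j js [B' [oB' nB' B'B1 fg]]] := IH B1 => //.
- by exists y.
- by move=> z /B1B; exact: cf.
- by move=> j z js /B1B; apply: cg; rewrite inE js orbT.
- move=> z [Bz nez]; have [j] := cov z Bz.
  rewrite inE => /orP[/eqP ->|js] fz; last by exists j.
  by exfalso; apply: nez.
exists j; first by rewrite inE js orbT.
by exists B'; split=> // z /B'B1 /B1B.
Qed.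

Section Lifts.
Context {R : realType} {n : nat} {X : topologicalType}.
Implicit Types c d : chart R n X.

Definition lift (m : nat) (p : 'rV[R]_m -> X) (N : set 'rV[R]_m) c
    (q : 'rV[R]_m -> 'rV[R]_n) : Prop :=
  [/\ open N, smooth N q, q @` N `<=` chart_dom c &
    {in N, p =1 chart_map c \o q}].

Lemma chart_dom_open c : open (chart_dom c).
Proof.
by have [b [r [_ ->]]] := chart_dom_ball c; exact: euclidean_ball_open.
Qed.

(** The map induced by the chart on the orbit space is injective. *)
Lemma chart_fiber c x y : chart_dom c x -> chart_dom c y ->
  chart_map c x = chart_map c y -> exists2 g, chart_group c g & x = g y.
Proof.
move=> cx cy xy; have [f [fE [[_ finj _] _]]] := chart_homeo c.
have : orbit (chart_group c) x = orbit (chart_group c) y.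
  by apply: finj; rewrite ?inE ?fE //; [exists x|exists y].
have [_ _ Gid _ _] := chart_groupP c.
have xx : orbit (chart_group c) x x by exists id.
by move=> E; move: xx; rewrite E => -[g Gg <-]; exists g.
Qed.

(** If the pullbacks differed at [x], they would differ on a neighbourhood [B]
    of [x] by continuity. On some nonempty open part of [B] the two lifts differ
    by a single element of the chart group, and invariance gives equality. *)
Lemma pullback_lift_unique (k m : nat) c (w : form k (chart_dom c))
    (p : 'rV[R]_m -> X) (N N' : set 'rV[R]_m) q q' x :
  (forall g, chart_group c g -> eq_form_on (chart_dom c) (pullback g w) w) ->
  lift p N c q -> lift p N' c q' -> N x -> N' x ->
  pullback q w x = pullback q' w x.
Proof.
move=> inv [oN Sq qN pq] [oN' Sq' qN' pq'] Nx N'x; apply/funext => v.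
apply/eqP; apply: contrapT => /negP neq.
pose M := N `&` N'.
have oM : open M by exact: openI.
have domq y : M y -> chart_dom c (q y) by move=> [Ny _]; apply: qN; exists y.
have domq' y : M y -> chart_dom c (q' y) by move=> [_ Ny]; apply: qN'; exists y.
pose h y := pullback q w y v - pullback q' w y v.
have Sh : smooth M h.
  by apply: smoothB => //; apply: pullback_smooth => //;
    [move=> _ [y My <-]; exact: domq|apply: smooth_sub Sq => y []
    |move=> _ [y My <-]; exact: domq'|apply: smooth_sub Sq' => y []].
pose B := M `&` h @^-1` [set~ 0].
have oB : open B.
  by apply: open_preimage_smooth Sh _ => //; apply: closed_openC; exact: closed_eq.
have Bx : B x by split=> //= /eqP; rewrite subr_eq0; exact/negP.
have [/finite_seqP[s sG] Gdiff _ _ _] := chart_groupP c.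
have Gsmooth g : chart_group c g -> smooth (chart_dom c) g.
  by move=> /Gdiff[[]].
have hV : hausdorff_space 'rV[R]_n by exact: norm_hausdorff.
have [||||g gs [B' [oB' [y B'y] B'B qg]]] :=
  @finite_coincidence 'rV[R]_m 'rV[R]_n _ s q (fun g => g \o q') B hV oB.
- by exists x.
- by move=> y [[Ny _] _]; exact: smooth_continuous Sq Ny.
- move=> g y gs [My _]; have [_ N'y] := My; apply: continuous_comp.
    exact: smooth_continuous Sq' N'y.
  by apply: (smooth_continuous (Gsmooth g _) (domq' _ My)); rewrite sG.
- move=> y [My _]; have [Ny N'y] := My.
  have [|g Gg qg] := chart_fiber (domq _ My) (domq' _ My).
    exact: etrans (esym (pq y (mem_set Ny))) (pq' y (mem_set N'y)).
  by exists g => //; move: Gg; rewrite sG.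
have Gg : chart_group c g by rewrite sG.
have [My hy] := B'B y B'y; apply: hy; rewrite /h /=.
have near_qg : \forall z \near y, q z = (g \o q') z.
  by have := open_nbhs_nbhs (conj oB' B'y); exact: filterS.
have [Ny N'y] := My.
rewrite (near_eq_pullback _ near_qg); last exact: smooth_differentiable Sq Ny.
rewrite pullback_comp.
- by rewrite {1}/pullback inv ?subrr //; exact: domq'.
- exact: smooth_differentiable Sq' N'y.
- exact: smooth_differentiable (Gsmooth g Gg) (domq' _ My).
Qed.

(** Some transition map [g] from [q x] to [q' x] matches the two forms; then
    [g \o q] and [q'] lift [p] to the same chart. Other transition maps may a
    priori fail to match the forms, but a single one suffices. *)
Lemma orbifold_pullback_lift_unique (A : orbifold_atlas R n X) (k m : nat)
    (w : orbifold_form A k) c d (Ac : charts A c) (Ad : charts A d)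
    (p : 'rV[R]_m -> X) (N N' : set 'rV[R]_m) q q' x :
  lift p N c q -> lift p N' d q' -> N x -> N' x ->
  pullback q (w c Ac) x = pullback q' (w d Ad) x.
Proof.
move=> lq lq' Nx N'x.
have [oN Sq qN pq] := lq; have [oN' Sq' qN' pq'] := lq'.
have cq : chart_dom c (q x) by apply: qN; exists x.
have dq' : chart_dom d (q' x) by apply: qN'; exists x.
have cqdq : chart_map c (q x) = chart_map d (q' x).
  exact: etrans (esym (pq x (mem_set Nx))) (pq' x (mem_set N'x)).
have [D [E' [g [[[Du Dc] [E'v E'd] [oD oE' Sg gD _] gx cg] wg]]]] :=
  oform_transition w Ac Ad cq dq' cqdq.
have dgq : pullback q (w c Ac) x = pullback (g \o q) (w d Ad) x.
  rewrite pullback_comp; last exact: smooth_differentiable Sg Du.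
    by rewrite /pullback -wg.
  exact: smooth_differentiable Sq Nx.
have lgq : lift p (N `&` q @^-1` D) d (g \o q).
  split.
  - exact: open_preimage_smooth.
  - exact: smooth_comp_preimage.
  - by move=> _ [y [_ Dy] <-]; apply/E'd/gD; exists (q y).
  - move=> y /set_mem[Ny Dy].
    exact: etrans (pq y (mem_set Ny)) (esym (cg (q y) (mem_set Dy))).
apply: (etrans dgq).
have inv h := oform_invariant w Ad (g := h).
exact: (pullback_lift_unique inv lgq lq' (conj Nx Du) N'x).
Qed.

End Lifts.

(** * The two constructions and their composites *)

Section DiffeologicalOfOrbifold.
Context {R : realType} {n : nat} {X : topologicalType}.
Variables (A : orbifold_atlas R n X) (k : nat).

Section PlotForm.
Variable w : orbifold_form A k.

(** The set of candidate values is empty for [x] outside [W], where [xget]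
    returns the default [0] that forms take there; for [x] in [W] it is a
    singleton. *)
Definition plot_form_val (m : nat) (W : set 'rV[R]_m) (p : 'rV[R]_m -> X)
    (x : 'rV[R]_m) (v : 'I_k -> 'rV[R]_m) : R :=
  xget 0 [set r | W x /\ exists N c q (Ac : charts A c),
    [/\ N x, lift p N c q & r = pullback q (w c Ac) x v]].

Lemma plot_form_val_out m (W : set 'rV[R]_m) (p : 'rV[R]_m -> X) x v :
  ~ W x -> plot_form_val W p x v = 0.
Proof. by move=> nWx; apply: xgetPN => r [/nWx]. Qed.

Lemma plot_form_valE m (W : set 'rV[R]_m) (p : 'rV[R]_m -> X) N c q
    (Ac : charts A c) x :
  W x -> N x -> lift p N c q ->
  plot_form_val W p x = pullback q (w c Ac) x.
Proof.
move=> Wx Nx lq; apply/funext => v; apply: xget_unique.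
  by split=> //; exists N, c, q, Ac.
move=> _ [_ [N' [c' [q' [Ac' [N'x lq' ->]]]]]].
by rewrite (orbifold_pullback_lift_unique w Ac' Ac lq' lq).
Qed.

Lemma orbifold_plot_lift m (W : set 'rV[R]_m) (p : 'rV[R]_m -> X) x :
  plot (orbifold_diffeology A) W p -> W x ->
  exists N c q, [/\ charts A c, N x, N `<=` W & lift p N c q].
Proof.
move=> [oW Wp] /Wp[N [oN Nx NW [c [q [Ac Sq qc pq]]]]].
by exists N, c, q.
Qed.

Section PlotFormOf.
Variables (m : nat) (W : set 'rV[R]_m) (p : 'rV[R]_m -> X).
Hypothesis Wp : plot (orbifold_diffeology A) W p.

Lemma plot_form_multilinear x : W x -> multilinear (plot_form_val W p x).
Proof.
move=> Wx; have [N [c [q [Ac Nx _ lq]]]] := orbifold_plot_lift Wp Wx.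
rewrite (plot_form_valE Ac Wx Nx lq); apply/pullback_multilinear.
by apply: form_multilinear; have [_ _ + _] := lq; apply; exists x.
Qed.

Lemma plot_form_alternating x : W x -> alternating (plot_form_val W p x).
Proof.
move=> Wx; have [N [c [q [Ac Nx _ lq]]]] := orbifold_plot_lift Wp Wx.
rewrite (plot_form_valE Ac Wx Nx lq); apply/pullback_alternating.
by apply: form_alternating; have [_ _ + _] := lq; apply; exists x.
Qed.

Lemma plot_form_smooth v : smooth W (fun x => plot_form_val W p x v).
Proof.
apply: smooth_local => x Wx.
have [N [c [q [Ac Nx NW lq]]]] := orbifold_plot_lift Wp Wx.
exists N => //; have [oN Sq qN _] := lq.
apply: smooth_ext (pullback_smooth (w c Ac) v oN qN Sq) => // y Ny.
by rewrite (plot_form_valE Ac (NW _ Ny) Ny lq).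
Qed.

Definition plot_form : form k W :=
  Form plot_form_multilinear plot_form_alternating plot_form_smooth
    (@plot_form_val_out m W p).

End PlotFormOf.

(** If [f] lifts [p] near [F x], then [f \o F] lifts [p \o F] near [x], and the
    claim is the functoriality of pullback. *)
Lemma plot_form_pullback l m (V : set 'rV[R]_l) (W : set 'rV[R]_m)
    (F : 'rV[R]_l -> 'rV[R]_m) (p : 'rV[R]_m -> X) (q : 'rV[R]_l -> X)
    (Wp : plot (orbifold_diffeology A) W p)
    (Vq : plot (orbifold_diffeology A) V q) :
  smooth V F -> F @` V `<=` W -> {in V, q =1 p \o F} ->
  eq_form_on V (plot_form Vq) (pullback F (plot_form Wp)).
Proof.
move=> SF FV qpF x Vx.
have WFx : W (F x) by apply: FV; exists x.
have [N [c [f [Ac Nx NW lf]]]] := orbifold_plot_lift Wp WFx.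
have oV : open V := plot_open Vq.
have [oN Sf fN pf] := lf.
have lfF : lift q (V `&` F @^-1` N) c (f \o F).
  split.
  - exact: open_preimage_smooth.
  - exact: smooth_comp_preimage.
  - by move=> _ [y [_ Ny] <-]; apply: fN; exists (F y).
  - move=> y /set_mem[Vy Ny].
    exact: etrans (qpF y (mem_set Vy)) (pf (F y) (mem_set Ny)).
rewrite /= (plot_form_valE Ac Vx _ lfF) //.
rewrite pullback_comp; last exact: smooth_differentiable Sf Nx.
  by rewrite /pullback (plot_form_valE Ac WFx Nx lf).
exact: smooth_differentiable SF Vx.
Qed.

Definition diffeological_of_orbifold :
    diffeological_form (orbifold_diffeology A) k :=
  DiffeologicalForm plot_form_pullback.

End PlotForm.

Section ChartForms.
Variable a : diffeological_form (orbifold_diffeology A) k.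

Lemma orbifold_plot_restrict m (V W : set 'rV[R]_m) (p : 'rV[R]_m -> X) :
  open V -> V `<=` W -> plot (orbifold_diffeology A) W p ->
  plot (orbifold_diffeology A) V p.
Proof.
move=> oV VW.
apply: (@plot_comp _ _ (orbifold_diffeology A) _ _ _ _ id) => //.
  exact: smooth_id.
by move=> _ [y Vy <-]; exact: VW.
Qed.

Lemma dform_plot_restrict m (V W : set 'rV[R]_m) (p : 'rV[R]_m -> X)
    (Wp : plot (orbifold_diffeology A) W p)
    (Vp : plot (orbifold_diffeology A) V p) :
  V `<=` W -> eq_form_on V (a _ _ _ Vp) (a _ _ _ Wp).
Proof.
move=> VW; rewrite -[X in eq_form_on _ _ X]pullback_id.
apply: dform_pullback => //; first exact: smooth_id.
by move=> _ [y Vy <-]; exact: VW.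
Qed.

(** [chart_map c \o g = chart_map c], so this is the compatibility of [a] with
    the reparametrisation [g]. *)
Lemma chart_form_invariant c (Ac : charts A c) g : chart_group c g ->
  eq_form_on (chart_dom c) (pullback g (a _ _ _ (chart_plot Ac)))
    (a _ _ _ (chart_plot Ac)).
Proof.
move=> Gg x cx; have [_ /(_ g Gg)[[_ _ Sg gc _] _] _ _ _] := chart_groupP c.
apply/esym; apply: dform_pullback => // y; rewrite inE => cy /=.
by rewrite chart_invariant.
Qed.

(** On [D], the plot [chart_map c] is both a restriction of the plot of [c] and
    the reparametrisation by [g] of the plot of [d]. *)
Lemma chart_form_transition c d (Ac : charts A c) (Ad : charts A d) u v :
  chart_dom c u -> chart_dom d v -> chart_map c u = chart_map d v ->
  exists D E' g, transition c d u v D E' g /\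
    eq_form_on D (pullback g (a _ _ _ (chart_plot Ad)))
      (a _ _ _ (chart_plot Ac)).
Proof.
move=> cu dv uv.
have [D [E' [g tg]]] := charts_compatible Ac Ad cu dv uv.
exists D, E', g; split=> //.
have [[Du Dc] [E'v E'd] [oD oE' Sg gD _] gu cg] := tg.
have Dplot := orbifold_plot_restrict oD Dc (chart_plot Ac).
move=> x Dx; rewrite -(dform_plot_restrict (chart_plot Ac) Dplot Dc) //.
apply/esym; apply: dform_pullback => //.
  by move=> y Dy; apply/E'd/gD.
by move=> y Dy; rewrite -cg.
Qed.

Definition orbifold_of_diffeological : orbifold_form A k :=
  OrbifoldForm chart_form_invariant chart_form_transition.

End ChartForms.

Lemma dform_eq (a b : diffeological_form (orbifold_diffeology A) k) :
  (forall m (W : set 'rV[R]_m) p (Wp : plot (orbifold_diffeology A) W p),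
    eq_form_on W (a _ _ _ Wp) (b _ _ _ Wp)) -> a = b.
Proof.
move=> ab; have {ab} : dform_val a = dform_val b.
  do 4 apply: functional_extensionality_dep => ?.
  by apply: form_eq; exact: ab.
case: a b => a aP [b bP] /= ab; subst b.
by congr DiffeologicalForm; exact: Prop_irrelevance.
Qed.

Lemma oform_eq (w w' : orbifold_form A k) :
  (forall c (Ac : charts A c),
    eq_form_on (chart_dom c) (w c Ac) (w' c Ac)) -> w = w'.
Proof.
move=> ww'; have {ww'} : oform_val w = oform_val w'.
  do 2 apply: functional_extensionality_dep => ?.
  by apply: form_eq; exact: ww'.
case: w w' => w wi wt [w' wi' wt'] /= ww'; subst w'.
by congr OrbifoldForm; exact: Prop_irrelevance.
Qed.

(** On the domain of a local lift [q], both forms take the value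
    [q^* (a (chart_map c))]. *)
Lemma orbifold_of_diffeologicalK :
  cancel orbifold_of_diffeological diffeological_of_orbifold.
Proof.
move=> a; apply: dform_eq => m W p Wp x Wx.
have [N [c [q [Ac Nx NW lq]]]] := orbifold_plot_lift Wp Wx.
have [oN Sq qN pq] := lq.
have Np := orbifold_plot_restrict oN NW Wp.
apply: etrans (plot_form_valE _ Ac Wx Nx lq) _.
apply: etrans (dform_plot_restrict a Wp Np NW Nx).
by apply/esym; exact: (dform_pullback a (chart_plot Ac) Np).
Qed.

(** The plot [chart_map c] is lifted by the identity. *)
Lemma diffeological_of_orbifoldK :
  cancel diffeological_of_orbifold orbifold_of_diffeological.
Proof.
move=> w; apply: oform_eq => c Ac x cx.
have lid : lift (chart_map c) (chart_dom c) c id.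
  split=> //; [exact: chart_dom_open|exact: smooth_id|].
  by move=> _ [y cy <-].
by apply: etrans (plot_form_valE _ Ac cx cx lid) _; rewrite pullback_id.
Qed.

End DiffeologicalOfOrbifold.

Theorem mainTheorem2 (R : realType) (n : nat) (hn : (0 < n)%N)
    (X : topologicalType) (hX : hausdorff_space X) (sX : @second_countable X)
    (A : orbifold_atlas R n X) (k : nat) :
  exists Phi : diffeological_form (orbifold_diffeology A) k -> orbifold_form A k,
    (forall (alpha : diffeological_form (orbifold_diffeology A) k)
        (c : chart R n X) (Ac : charts A c),
      Phi alpha c Ac = alpha n (chart_dom c) (chart_map c) (chart_plot Ac)) /\
    bijective Phi.
Proof.
exists (@orbifold_of_diffeological R n X A k); split=> //.
exists (@diffeological_of_orbifold R n X A k).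
- exact: orbifold_of_diffeologicalK.
- exact: diffeological_of_orbifoldK.
Qed.
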